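(* Let $i\geqslant0$ and $U\in\mathcal{B}([0,n],i+1)$. For any maximal chain $\mathcal{W}$ of the reoriented higher Bruhat order $\mathcal{B}_U([0,n],i+1)$ from $U$ to $\binom{[0,n]}{i+2}\setminus U$, the coproduct $\Delta_{i+1}^{\mathcal{W}}\colon C_\bullet(\Delta^n)\to C_\bullet(\Delta^n)\otimes C_\bullet(\Delta^n)$ satisfies $$\partial\circ\Delta_{i+1}^{\mathcal{W}}-(-1)^{i+1}\,\Delta_{i+1}^{\mathcal{W}}\circ\partial=(1+(-1)^{i+1}T)\,\Delta_i^U .$$
   Context: Notation. $[0,n]=\{0,\dots,n\}$. $\binom{S}{k}$ is the set of $k$-element subsets of $S$; $|S|$ is the cardinality; $|S|_{<x}=|\{s\in S: s<x\}|$, $|S|_{>x}=|\{s\in S:s>x\}|$. Chains. $C_\bullet(\Delta^n)$ is the chain complex of free $\mathbb{Z}$-modules with basis the non-empty subsets $X\subseteq[0,n]$, $X$ in degree $|X|-1$, with $\partial\{v_0<\dots<v_q\}=\sum_{p=0}^q(-1)^p\{v_0,\dots,\hat v_p,\dots,v_q\}$ for $q\geqslant1$ and $\partial=0$ in degree $0$. On the tensor product, $\partial(x\otimes y)=\partial x\otimes y+(-1)^{\deg x}x\otimes\partial y$ and $T(x\otimes y)=(-1)^{\deg x\deg y}\,y\otimes x$. Consistent sets. $\mathcal{B}([0,n],i+1)$ is the set of consistent subsets $U\subseteq\binom{[0,n]}{i+2}$: for every $M=\{m_0<\dots<m_{i+2}\}\in\binom{[0,n]}{i+3}$, the set of $K\in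 U$ with $K\subset M$ is a beginning or an ending segment (possibly empty or everything) of $M\setminus m_{i+2}<\dots<M\setminus m_1<M\setminus m_0$. Reoriented order. For $U,V\in\mathcal{B}([0,n],i+1)$, $\operatorname{inv}_U(V)=(U\setminus V)\cup(V\setminus U)$. The poset $\mathcal{B}_U([0,n],i+1)$ has underlying set $\mathcal{B}([0,n],i+1)$ and covering relations $V\lessdot V'$ iff $\operatorname{inv}_U(V')=\operatorname{inv}_U(V)\cup\{L\}$ for some $L\notin\operatorname{inv}_U(V)$. A maximal chain $\mathcal{W}$ from $U$ to $\binom{[0,n]}{i+2}\setminus U$ is thus a sequence $U=V_0\lessdot V_1\lessdot\dots\lessdot V_p=\binom{[0,n]}{i+2}\setminus U$ with $\operatorname{inv}_U(V_q)=\{L_1,\dots,L_q\}$, $L_q\in\binom{[0,n]}{i+2}$. Sign. For disjoint $L,A,B$ with union $S$, $\varepsilon_S(L,A,B)=\sum_{b\in B}|A|_{<b}+\sum_{l\in L}|L|_{<l}+|S|\,|A|\in\mathbb{Z}/2\mathbb{Z}$. The coproduct $\Delta_i^U$. For $U\in\mathcal{B}([0,n],i+1)$, non-empty $S\subseteq[0,n]$ and $L\in\binom{S}{i+1}$, let $A_L^{U,S}$ be the set of $a\in S\setminus L$ such that either $L\cup\{a\}\in U$ and $|L|_{>a}$ is even, or $L\cup\{a\}\notin U$ and $|L|_{>a}$ is odd; let $B_L^{U,S}=S\setminus(L\cup A_L^{U,S})$. Then, with $A=A_L^{U,S}$, $B=B_L^{U,S}$, $\Delta_i^U(S)=\sum_{L\in\binom{S}{i+1}}(-1)^{\varepsilon_S(L,A,B)}(L\cup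 A)\otimes(L\cup B)$, extended linearly. The coproduct $\Delta_{i+1}^{\mathcal{W}}$. The $q$-th step of $\mathcal{W}$ (from $V_{q-1}$ to $V_q$, which differ exactly in $L_q$) corresponds to the $(i+2)$-dimensional face $F_q$ of the cyclic zonotope $Z([0,n],n+1)$ (the Minkowski sum of the segments from $0$ to $\xi_t=(1,t,\dots,t^n)$, $t=0,\dots,n$) across which the two associated cubillages differ; it has generating vectors $L_q$ and initial vertex $A_q=A_{L_q\setminus l}^{V_q,[0,n]}\setminus\{l\}$, which is the same set for every $l\in L_q$ (and the same with $V_{q-1}$ in place of $V_q$). Put $B_q=[0,n]\setminus(L_q\cup A_q)$. For non-empty $S\subseteq[0,n]$ define $\Delta_{i+1}^{F_q}(S)=(-1)^{\varepsilon_S(L_q,A_q\cap S,B_q\cap S)}(L_q\cup(A_q\cap S))\otimes(L_q\cup(B_q\cap S))$ if $L_q\subseteq S$, and $0$ otherwise. Then $$\Delta_{i+1}^{\mathcal{W}}=\sum_{q:\,L_q\notin U}\Delta_{i+1}^{F_q}-\sum_{r:\,L_r\in U}\Delta_{i+1}^{F_r}.$$ *)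

(* Defs.v *)
From mathcomp Require Import all_boot all_order all_algebra.

Set Implicit Arguments.
Unset Strict Implicit.
Unset Printing Implicit Defensive.

Import GRing.Theory.
Local Open Scope ring_scope.

(* The vertex set [0, n] is 'I_n.+1. *)

Section Subsets.
Variable n : nat.
Implicit Types (S L : {set 'I_n.+1}) (x : 'I_n.+1).

Definition ksubsets S (k : nat) : {set {set 'I_n.+1}} :=
  [set L : {set 'I_n.+1} | L \subset S & #|L| == k].

Definition card_lt S x : nat := #|[set s in S | (s < x)%N]|.
Definition card_gt S x : nat := #|[set s in S | (x < s)%N]|.

End Subsets.

(* A free Z-module on a finite basis I is {ffun I -> int}, and its tensor
   square is the free module on I * I. *)

Definition simplex (n : nat) := {X : {set 'I_n.+1} | X != set0}.
Definition chains (n : nat) := {ffun simplex n -> int}.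
Definition chains2 (n : nat) := {ffun simplex n * simplex n -> int}.

Definition linext (I : finType) (M : zmodType) (f : I -> M)
    (c : {ffun I -> int}) : M :=
  \sum_(j : I) f j *~ c j.

Section Chains.
Variable n : nat.
Implicit Types (X Y : {set 'I_n.+1}).

(* The basis element X, for non-empty X; the junk value at set0 is 0. *)
Definition basis X : chains n := [ffun Y : simplex n => (val Y == X)%:R].

Definition tens (x y : chains n) : chains2 n := [ffun p => x p.1 * y p.2].

Definition deg X : nat := #|X|.-1.

(* In X = {v_0 < ... < v_q}, the index of a vertex v is card_lt X v. *)
Definition bdry_basis X : chains n :=
  if (0 < deg X)%N then \sum_(v in X) basis (X :\ v) *~ (-1) ^+ card_lt X v
  else 0.

Definition bdry : chains n -> chains n :=
  linext (fun X : simplex n => bdry_basis (val X)).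

Definition bdry2 : chains2 n -> chains2 n :=
  linext (fun p : simplex n * simplex n =>
    let X := val p.1 in let Y := val p.2 in
    tens (bdry_basis X) (basis Y)
    + tens (basis X) (bdry_basis Y) *~ (-1) ^+ deg X).

Definition twist : chains2 n -> chains2 n :=
  linext (fun p : simplex n * simplex n =>
    let X := val p.1 in let Y := val p.2 in
    tens (basis Y) (basis X) *~ (-1) ^+ (deg X * deg Y)%N).

End Chains.

Section HigherBruhat.
Variable n : nat.
Implicit Types (M L : {set 'I_n.+1}) (U V : {set {set 'I_n.+1}}).

(* The packet of M is ordered by M :\ y < M :\ x iff x < y. *)
Definition beginning_segment M U : bool :=
  [forall x in M, forall y in M,
     (x < y)%N ==> (M :\ x \in U) ==> (M :\ y \in U)].
Definition ending_segment M U : bool :=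
  [forall x in M, forall y in M,
     (x < y)%N ==> (M :\ y \in U) ==> (M :\ x \in U)].

(* B([0, n], k) *)
Definition bruhat (k : nat) : {set {set {set 'I_n.+1}}} :=
  [set U : {set {set 'I_n.+1}} |
     (U \subset ksubsets [set: 'I_n.+1] k.+1)
     && [forall M in ksubsets [set: 'I_n.+1] k.+2,
           beginning_segment M U || ending_segment M U]].

(* inv_U(V) *)
Definition inv_set U V : {set {set 'I_n.+1}} := (U :\: V) :|: (V :\: U).

(* Covering relation of the reoriented order B_U([0, n], k) on bruhat k. *)
Definition covers U V V' : bool :=
  [exists L : {set 'I_n.+1},
     (L \notin inv_set U V) && (inv_set U V' == L |: inv_set U V)].

(* W = [:: V_0; ...; V_p] *)
Definition maximal_chain (k : nat) U (W : seq {set {set 'I_n.+1}}) : bool :=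
  [&& all [in bruhat k] W, ohead W == Some U, sorted (covers U) W
    & last U W == ksubsets [set: 'I_n.+1] k.+1 :\: U].

End HigherBruhat.

Section Coproducts.
Variable n : nat.
Implicit Types (S L A B : {set 'I_n.+1}) (U V : {set {set 'I_n.+1}}).
Implicit Types (W : seq {set {set 'I_n.+1}}).

(* A natural number whose class mod 2 is the sign exponent. *)
Definition eps S L A B : nat :=
  (\sum_(b in B) card_lt A b + \sum_(l in L) card_lt L l + #|S| * #|A|)%N.

(* A_L^{U,S} and B_L^{U,S} *)
Definition Aset U S L : {set 'I_n.+1} :=
  [set a in S :\: L |
     ((a |: L \in U) && ~~ odd (card_gt L a))
     || ((a |: L \notin U) && odd (card_gt L a))].
Definition Bset U S L : {set 'I_n.+1} := S :\: (L :|: Aset U S L).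

(* The signed term shared by both coproducts. *)
Definition coprod_term S L A B : chains2 n :=
  tens (basis (L :|: A)) (basis (L :|: B)) *~ (-1) ^+ eps S L A B.

(* Delta_i^U *)
Definition coprod (i : nat) U : chains n -> chains2 n :=
  linext (fun X : simplex n => let S := val X in
    \sum_(L in ksubsets S i.+1) coprod_term S L (Aset U S L) (Bset U S L)).

(* L_q: the unique set in which V_{q-1} and V_q differ, for 0 < q < size W. *)
Definition step_set W (q : nat) : {set 'I_n.+1} :=
  odflt set0 [pick L in inv_set (nth set0 W q.-1) (nth set0 W q)].

(* Along a maximal chain the result does not depend on the l picked in L. *)
Definition initial_vertex V L : {set 'I_n.+1} :=
  if [pick l in L] is Some l then Aset V [set: 'I_n.+1] (L :\ l) :\ l
  else set0.

(* Delta^F, for the face F with generating vectors L and initial vertex A. *)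
Definition coprod_face L A : chains n -> chains2 n :=
  linext (fun X : simplex n => let S := val X in
    let B := ~: (L :|: A) in
    if L \subset S then coprod_term S L (A :&: S) (B :&: S) else 0).

Definition coprod_step W (q : nat) : chains n -> chains2 n :=
  coprod_face (step_set W q) (initial_vertex (nth set0 W q) (step_set W q)).

(* Delta_{i+1}^W, for W a maximal chain of B_U([0, n], i+1) *)
Definition coprod_chain U W (c : chains n) : chains2 n :=
  \sum_(1 <= q < size W | step_set W q \notin U) coprod_step W q c
  - \sum_(1 <= r < size W | step_set W r \in U) coprod_step W r c.

End Coproducts.

(* Main.v *)
Require Import Defs.
From mathcomp Require Import all_boot all_order all_algebra.

(** For a fixed simplex [S], the boundary of the term [(L u A) (x) (L u B)] of
    a face [F] splits in two. Removing a vertex of [A] or [B] gives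
    [(-1)^(i+1)] times [Delta^F] of the boundary of [S]. Removing a vertex [l]
    of [L] gives the terms of the two opposite facets of [F] with generating
    vectors [L \ l]. Since [V_(q-1)] and [V_q] differ exactly in [L_q], these
    facet terms add up to the difference of [Delta_i^(V_(q-1))] and
    [Delta_i^(V_q)], so the sum over the chain telescopes to [Delta_i] of [U]
    minus [Delta_i] of its complement. The latter is [T Delta_i^U] up to sign,
    because complementing [U] exchanges [A_L] and [B_L]. *)

Set Implicit Arguments.
Unset Strict Implicit.
Unset Printing Implicit Defensive.

Import GRing.Theory.
Local Open Scope ring_scope.

(** * Linear extensions and signs *)

Lemma eq_linext (I : finType) (M : zmodType) (f g : I -> M) :
  f =1 g -> linext f =1 linext g.
Proof. by move=> fg c; apply: eq_bigr => j _; rewrite fg. Qed.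

Lemma linext_sum (I : finType) (M : zmodType) (f : I -> M) (J : Type)
    (r : seq J) (P : pred J) (c : J -> {ffun I -> int}) :
  linext f (\sum_(j <- r | P j) c j) = \sum_(j <- r | P j) linext f (c j).
Proof.
rewrite exchange_big /=; apply: eq_bigr => x _.
by rewrite sum_ffunE mulrz_sumr.
Qed.

Lemma linextMz (I : finType) (M : zmodType) (f : I -> M) c (z : int) :
  linext f (c *~ z) = linext f c *~ z.
Proof.
rewrite /linext mulrz_suml; apply: eq_bigr => x _.
by rewrite ffunMzE mulrzz mulrzA.
Qed.

Lemma linext_linext (I J : finType) (M : zmodType) (f : J -> M)
    (g : I -> {ffun J -> int}) c :
  linext f (linext g c) = linext (fun j => linext f (g j)) c.
Proof. by rewrite linext_sum; apply: eq_bigr => j _; rewrite linextMz. Qed.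

Lemma linext_addf (I : finType) (M : zmodType) (f g : I -> M) c :
  linext f c + linext g c = linext (fun j => f j + g j) c.
Proof. by rewrite -big_split /=; apply: eq_bigr => j _; rewrite mulrzDl. Qed.

Lemma linext_mulzf (I : finType) (M : zmodType) (f : I -> M) c (z : int) :
  linext f c *~ z = linext (fun j => f j *~ z) c.
Proof.
by rewrite /linext mulrz_suml; apply: eq_bigr => j _; rewrite mulrzAC.
Qed.

Lemma linext_oppf (I : finType) (M : zmodType) (f : I -> M) c :
  - linext f c = linext (fun j => - f j) c.
Proof.
rewrite -(mulrN1z (linext f c)) linext_mulzf.
by apply: eq_linext => j; rewrite mulrN1z.
Qed.

Lemma linext_delta (I : finType) (M : zmodType) (f : I -> M) (j : I) :
  linext f [ffun i => (i == j)%:R] = f j.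
Proof.
rewrite /linext (bigD1 j) //= ffunE eqxx big1 ?addr0 // => i /negPf ne.
by rewrite ffunE ne.
Qed.

Lemma signz_eq (M : zmodType) (x : M) (e f : nat) :
  odd e = odd f -> x *~ (-1) ^+ e = x *~ (-1) ^+ f.
Proof. by move=> ef; rewrite -(signr_odd _ e) ef signr_odd. Qed.

Lemma signz_add (M : zmodType) (x : M) (e f : nat) :
  x *~ (-1) ^+ e *~ (-1) ^+ f = x *~ (-1) ^+ (e + f)%N.
Proof. by rewrite -mulrzA exprD. Qed.

Lemma signzB (M : zmodType) (x y : M) (e : nat) :
  (x - y) *~ (-1) ^+ e = x *~ (-1) ^+ e + y *~ (-1) ^+ e.+1.
Proof. by rewrite exprS mulN1r mulrNz mulrzBl. Qed.

(** Meant for [x], [y] the terms of two opposite facets, [b] the membership of [L] in [V] and [c]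
    the parity of [card_gt L l]: the sign on the right does not depend on [l]. *)
Lemma sub_toggle (M : zmodType) (x y : M) (b c : bool) :
  (x - y) *~ (-1) ^+ c
  = ((if b (+) c then y else x) - (if ~~ b (+) c then y else x)) *~ (-1) ^+ b.
Proof. by case: b; case: c; rewrite /= ?(mulr1z, mulrN1z, opprB). Qed.

(** Sign exponents matter only modulo 2: once [odd] is pushed to the atoms, a truth table
    decides. *)
Ltac parity :=
  rewrite ?(oddD, oddM, oddS, oddb) /=;
  repeat match goal with |- context [odd ?x] => case: (odd x) end; done.

(** * Basis chains, boundaries and tensors *)

Section Chains.
Variable n : nat.
Implicit Types (X Y S L A B : {set 'I_n.+1}) (v l a b : 'I_n.+1).

Lemma basis0 : basis set0 = 0 :> chains n.
Proof. by apply/ffunP => -[Y Y0]; rewrite !ffunE /= (negPf Y0). Qed.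

(** Since [basis set0] is 0, the condition on [f] makes the formula hold for empty [X] too, so
    vanishing faces need no separate treatment. *)
Lemma linext_basis (M : zmodType) (f : {set 'I_n.+1} -> M) X :
  f set0 = 0 -> linext (fun Y : simplex n => f (val Y)) (basis X) = f X.
Proof.
have [->|X0 _] := eqVneq X set0.
  by move->; rewrite basis0 /linext big1 // => Y _; rewrite ffunE.
by rewrite -[RHS](linext_delta (fun Y : simplex n => f (val Y)) (exist _ X X0)).
Qed.

Lemma linext_tens_basis (M : zmodType)
    (f : {set 'I_n.+1} -> {set 'I_n.+1} -> M) X Y :
  X != set0 -> Y != set0 ->
  linext (fun p : simplex n * simplex n => f (val p.1) (val p.2))
    (tens (basis X) (basis Y)) = f X Y.
Proof.
move=> X0 Y0.
rewrite -(linext_delta (fun p : simplex n * simplex n => f (val p.1) (val p.2))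
  (exist _ X X0, exist _ Y Y0)); congr linext.
by apply/ffunP => -[X' Y']; rewrite !ffunE /= -natrM mulnb xpair_eqE.
Qed.

(** In degree 0 the only face is [set0], whose basis chain is 0, so the case distinction in
    [bdry_basis] disappears. *)
Lemma bdry_basisE X :
  bdry_basis X = \sum_(v in X) basis (X :\ v) *~ (-1) ^+ card_lt X v.
Proof.
rewrite /bdry_basis; case: ifPn => // degX; rewrite big1 // => v vX.
suff -> : X :\ v = set0 by rewrite basis0 mul0rz.
apply/eqP; rewrite -cards_eq0; move: degX; rewrite /deg (cardsD1 v X) vX.
by case: #|_|.
Qed.

Lemma tens_suml (J : Type) (r : seq J) (P : pred J) (x : J -> chains n)
    (z : J -> int) (y : chains n) :
  tens (\sum_(j <- r | P j) x j *~ z j) y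
  = \sum_(j <- r | P j) tens (x j) y *~ z j.
Proof.
apply/ffunP => p; rewrite ffunE !sum_ffunE mulr_suml; apply: eq_bigr => j _.
by rewrite !ffunMzE ffunE mulrzAl.
Qed.

Lemma tens_sumr (J : Type) (r : seq J) (P : pred J) (x : J -> chains n)
    (z : J -> int) (y : chains n) :
  tens y (\sum_(j <- r | P j) x j *~ z j)
  = \sum_(j <- r | P j) tens y (x j) *~ z j.
Proof.
apply/ffunP => p; rewrite ffunE !sum_ffunE mulr_sumr; apply: eq_bigr => j _.
by rewrite !ffunMzE ffunE mulrzAr.
Qed.

(** * Counting pairs for the sign exponent *)

Lemma card_ltE X v : card_lt X v = (\sum_(x in X) (x < v))%N.
Proof.
rewrite /card_lt -sum1_card big_mkcond /= [RHS]big_mkcond.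
by apply: eq_bigr => x _; rewrite inE; case: (x \in X); case: ltnP.
Qed.

Lemma card_gtE X v : card_gt X v = (\sum_(x in X) (v < x))%N.
Proof.
rewrite /card_gt -sum1_card big_mkcond /= [RHS]big_mkcond.
by apply: eq_bigr => x _; rewrite inE; case: (x \in X); case: ltnP.
Qed.

Lemma card_ltU X Y v : [disjoint X & Y] ->
  card_lt (X :|: Y) v = (card_lt X v + card_lt Y v)%N.
Proof.
move=> dXY; rewrite !card_ltE -bigU //.
by apply: eq_bigl => x; rewrite !inE.
Qed.

Lemma card_ltU1 X x v : x \notin X ->
  card_lt (x |: X) v = ((x < v) + card_lt X v)%N.
Proof. by move=> xX; rewrite !card_ltE big_setU1. Qed.

Lemma card_lt_gt X v : v \notin X -> (card_lt X v + card_gt X v)%N = #|X|.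
Proof.
move=> vX; rewrite card_ltE card_gtE -big_split -sum1_card.
apply: eq_bigr => x xX; case: ltngtP => // /val_inj xv.
by rewrite -xv xX in vX.
Qed.

Lemma card_gtD1 X v : card_gt (X :\ v) v = card_gt X v.
Proof.
apply: eq_card => x; rewrite !inE; case: eqP => //= ->.
by rewrite ltnn andbF.
Qed.

Lemma card_ltD1 X v : card_lt (X :\ v) v = card_lt X v.
Proof.
apply: eq_card => x; rewrite !inE; case: eqP => //= ->.
by rewrite ltnn andbF.
Qed.

(** The number of increasing pairs in the product of [A] and [B]; [cross L L] is the binomial
    coefficient of [#|L|] over 2. *)
Definition cross A B : nat := (\sum_(b in B) card_lt A b)%N.

Lemma cross_addl A B x : x \notin A ->
  cross (x |: A) B = (card_gt B x + cross A B)%N.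
Proof.
move=> xA; rewrite card_gtE -big_split; apply: eq_bigr => b _.
exact: card_ltU1.
Qed.

Lemma cross_addr A B x : x \notin B ->
  cross A (x |: B) = (card_lt A x + cross A B)%N.
Proof. exact: big_setU1. Qed.

(** Disjointness rules out ties, so each pair is increasing in exactly one of the two orders. *)
Lemma cross_sym A B : [disjoint A & B] ->
  (cross A B + cross B A)%N = (#|A| * #|B|)%N.
Proof.
move=> dAB; rewrite /cross.
under eq_bigr do rewrite card_ltE.
rewrite exchange_big -big_split /=.
rewrite -sum_nat_const; apply: eq_bigr => a aA.
rewrite -card_gtE addnC; apply: card_lt_gt.
by rewrite (disjointFr dAB).
Qed.

Lemma cross_diag_add L x : x \notin L ->
  cross (x |: L) (x |: L) = (#|L| + cross L L)%N.
Proof.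
move=> xL; rewrite cross_addl // cross_addr // -(card_lt_gt xL).
suff -> : card_gt (x |: L) x = card_gt L x by rewrite addnCA addnA.
by rewrite -card_gtD1 setU1K.
Qed.

Lemma epsE S L A B : eps S L A B = (cross A B + cross L L + #|S| * #|A|)%N.
Proof. by []. Qed.

Lemma sum_disjointU (M : zmodType) (F : 'I_n.+1 -> M) X Y : [disjoint X & Y] ->
  \sum_(v in X :|: Y) F v = \sum_(v in X) F v + \sum_(v in Y) F v.
Proof.
by move=> dXY; rewrite -bigU //; apply: eq_bigl => v; rewrite !inE.
Qed.

Lemma mulrz_sum_disjointU (M : zmodType) (F : 'I_n.+1 -> M) X Y (z : int) :
  [disjoint X & Y] ->
  (\sum_(v in X :|: Y) F v) *~ z
  = \sum_(v in X) F v *~ z + \sum_(v in Y) F v *~ z.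
Proof. by move=> dXY; rewrite sum_disjointU // mulrzDl !mulrz_suml. Qed.

Lemma card_disjointU X Y : [disjoint X & Y] -> #|X :|: Y| = (#|X| + #|Y|)%N.
Proof. by rewrite -leq_card_setU => /eqP. Qed.

Lemma setUD1l X Y v : v \notin Y -> (X :|: Y) :\ v = (X :\ v) :|: Y.
Proof.
move=> vY; apply/setP => x; rewrite !inE; case: eqVneq => //= ->.
by rewrite (negPf vY).
Qed.

Lemma setUD1r X Y v : v \notin X -> (X :|: Y) :\ v = X :|: (Y :\ v).
Proof. by move=> vX; rewrite setUC setUD1l // setUC. Qed.

Lemma setU_D1U1 X Y v : v \in X -> (X :\ v) :|: (v |: Y) = X :|: Y.
Proof. by move=> vX; rewrite setUA [_ :|: [set v]]setUC setD1K. Qed.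

Lemma bdry2_tens X Y : X != set0 -> Y != set0 ->
  bdry2 (tens (basis X) (basis Y))
  = tens (bdry_basis X) (basis Y)
    + tens (basis X) (bdry_basis Y) *~ (-1) ^+ deg X.
Proof.
move=> X0 Y0.
exact: (linext_tens_basis (fun X Y => tens (bdry_basis X) (basis Y)
  + tens (basis X) (bdry_basis Y) *~ (-1) ^+ deg X)).
Qed.

(** * Boundary of one signed tensor term *)

Section Term.
Variables S L A B : {set 'I_n.+1}.
Hypotheses (dLA : [disjoint L & A]) (dLB : [disjoint L & B]).
Hypotheses (dAB : [disjoint A & B]) (L0 : (0 < #|L|)%N).
Hypothesis (SE : S = L :|: A :|: B).

Let dLAB : [disjoint L :|: A & B].
Proof.
by rewrite -setI_eq0 setIUl setU_eq0 !setI_eq0 dLB.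
Qed.

Let cardS : #|S| = (#|L| + #|A| + #|B|)%N.
Proof. by rewrite SE !card_disjointU. Qed.

(** The removed [l] survives in the right factor, so it joins [B]. In the sign, the loss [#|L :\ l|]
    of [cross L L] absorbs [card_lt L l] and leaves [card_gt L l]. *)
Lemma bdry_left_gen l : l \in L ->
  tens (basis ((L :|: A) :\ l)) (basis (L :|: B))
     *~ (-1) ^+ card_lt (L :|: A) l *~ (-1) ^+ eps S L A B
  = coprod_term S (L :\ l) A (l |: B) *~ (-1) ^+ card_gt L l.
Proof.
move=> lL; have lL' : l \notin L :\ l by rewrite setD11.
have lA : l \notin A by rewrite (disjointFr dLA).
have lB : l \notin B by rewrite (disjointFr dLB).
rewrite /coprod_term setU_D1U1 // setUD1l // !signz_add !epsE.
apply: signz_eq; rewrite cross_addr // card_ltU // -card_ltD1 -(card_gtD1 L).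
rewrite -{2 3}(setD1K lL) cross_diag_add //.
rewrite -(card_lt_gt lL'); parity.
Qed.

(** Now [l] joins [A], which changes [#|S| * #|A|] by [#|S|]. With the Koszul sign this leaves one
    sign more than in [bdry_left_gen], so the two facets enter with opposite signs. *)
Lemma bdry_right_gen l : l \in L ->
  tens (basis (L :|: A)) (basis ((L :|: B) :\ l))
     *~ (-1) ^+ card_lt (L :|: B) l *~ (-1) ^+ deg (L :|: A)
     *~ (-1) ^+ eps S L A B
  = coprod_term S (L :\ l) (l |: A) B *~ (-1) ^+ (card_gt L l).+1.
Proof.
move=> lL; have lL' : l \notin L :\ l by rewrite setD11.
have lA : l \notin A by rewrite (disjointFr dLA).
have lB : l \notin B by rewrite (disjointFr dLB).
rewrite /coprod_term setU_D1U1 // setUD1l // !signz_add !epsE.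
apply: signz_eq; rewrite cross_addl // card_ltU // -card_ltD1 -(card_gtD1 L).
rewrite -{3 4}(setD1K lL) cross_diag_add // cardsU1 lA /deg.
rewrite card_disjointU // cardS (cardsD1 l L) lL /=.
rewrite -(card_lt_gt lL') -(card_lt_gt lB); parity.
Qed.

(** The indices of [a] in [S] and in [L :|: A] differ by [card_lt B a], [cross] loses [card_gt B a],
    and [#|S| * #|A|] changes by [#|L| + #|B| - 1] modulo 2. The contributions of [B] cancel. *)
Lemma bdry_left_vertex a : a \in A ->
  tens (basis ((L :|: A) :\ a)) (basis (L :|: B))
     *~ (-1) ^+ card_lt (L :|: A) a *~ (-1) ^+ eps S L A B
  = coprod_term (S :\ a) L (A :\ a) B *~ (-1) ^+ card_lt S a
     *~ (-1) ^+ #|L|.-1.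
Proof.
move=> aA; have aL : a \notin L by rewrite (disjointFl dLA).
have aB : a \notin B by rewrite (disjointFr dAB).
rewrite /coprod_term setUD1r // !signz_add !epsE; apply: signz_eq.
rewrite -{2}(setD1K aA) cross_addl ?setD11 //.
have -> : card_lt S a = (card_lt (L :|: A) a + card_lt B a)%N.
  by rewrite SE card_ltU.
have -> : #|S :\ a| = (#|L| + #|A :\ a| + #|B|)%N.
  have aS : a \in S by rewrite SE !inE aA ?orbT.
  have := cardS; rewrite (cardsD1 a S) (cardsD1 a A) aA aS !add1n addnS addSn.
  by case.
rewrite cardS (cardsD1 a A) aA -(card_lt_gt aB) -(prednK L0).
parity.
Qed.

(** The index of [b] and [cross] both account for [card_lt A b], which cancels; the loss [#|A|] of
    [#|S| * #|A|] cancels against the Koszul sign [#|L| + #|A| - 1]. *)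
Lemma bdry_right_vertex b : b \in B ->
  tens (basis (L :|: A)) (basis ((L :|: B) :\ b))
     *~ (-1) ^+ card_lt (L :|: B) b *~ (-1) ^+ deg (L :|: A)
     *~ (-1) ^+ eps S L A B
  = coprod_term (S :\ b) L A (B :\ b) *~ (-1) ^+ card_lt S b
     *~ (-1) ^+ #|L|.-1.
Proof.
move=> bB; have bL : b \notin L by rewrite (disjointFl dLB).
have bA : b \notin A by rewrite (disjointFl dAB).
rewrite /coprod_term setUD1r // !signz_add !epsE; apply: signz_eq.
rewrite -{2}(setD1K bB) cross_addr ?setD11 //.
have -> : card_lt S b = (card_lt A b + card_lt (L :|: B) b)%N.
  rewrite SE setUAC setUC card_ltU //.
  by rewrite -setI_eq0 setIUr setU_eq0 !setI_eq0 disjoint_sym dLA dAB.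
have -> : #|S :\ b| = (#|L| + #|A| + #|B :\ b|)%N.
  have bS : b \in S by rewrite SE !inE bB ?orbT.
  have := cardS; rewrite (cardsD1 b S) (cardsD1 b B) bB bS !add1n addnS.
  by case.
rewrite cardS (cardsD1 b B) bB /deg card_disjointU //.
rewrite -(prednK L0) addSn /=.
parity.
Qed.

Lemma bdry_left :
  tens (bdry_basis (L :|: A)) (basis (L :|: B)) *~ (-1) ^+ eps S L A B
  = \sum_(l in L) coprod_term S (L :\ l) A (l |: B) *~ (-1) ^+ card_gt L l
    + (\sum_(a in A) coprod_term (S :\ a) L (A :\ a) B *~ (-1) ^+ card_lt S a)
      *~ (-1) ^+ #|L|.-1.
Proof.
rewrite bdry_basisE tens_suml mulrz_sum_disjointU // mulrz_suml.
by rewrite (eq_bigr _ bdry_left_gen) (eq_bigr _ bdry_left_vertex).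
Qed.

Lemma bdry_right :
  tens (basis (L :|: A)) (bdry_basis (L :|: B)) *~ (-1) ^+ deg (L :|: A)
    *~ (-1) ^+ eps S L A B
  = \sum_(l in L) coprod_term S (L :\ l) (l |: A) B *~ (-1) ^+ (card_gt L l).+1
    + (\sum_(b in B) coprod_term (S :\ b) L A (B :\ b) *~ (-1) ^+ card_lt S b)
      *~ (-1) ^+ #|L|.-1.
Proof.
rewrite bdry_basisE tens_sumr mulrz_sum_disjointU // mulrzDl !mulrz_suml.
by rewrite (eq_bigr _ bdry_right_gen) (eq_bigr _ bdry_right_vertex).
Qed.

Lemma bdry2_coprod_term :
  bdry2 (coprod_term S L A B)
  = \sum_(l in L) (coprod_term S (L :\ l) A (l |: B)
                   - coprod_term S (L :\ l) (l |: A) B) *~ (-1) ^+ card_gt L l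
    + (\sum_(a in A) coprod_term (S :\ a) L (A :\ a) B *~ (-1) ^+ card_lt S a
       + \sum_(b in B) coprod_term (S :\ b) L A (B :\ b)
           *~ (-1) ^+ card_lt S b) *~ (-1) ^+ #|L|.-1.
Proof.
have U0 X : L :|: X != set0 by rewrite setU_eq0 -cards_eq0 eqn0Ngt L0.
rewrite [coprod_term S L A B in LHS]/coprod_term /bdry2 linextMz.
rewrite -/(bdry2 _) bdry2_tens // mulrzDl bdry_left bdry_right.
apply: (etrans (addrACA _ _ _ _)); rewrite -mulrzDl; congr (_ + _).
rewrite -big_split; apply: eq_bigr => l _.
by rewrite signzB.
Qed.

End Term.
End Chains.

(** * One step between consistent sets, and its initial vertex *)

Section Bruhat.
Variable n : nat.
Implicit Types (M X S L : {set 'I_n.+1}) (l a x y z : 'I_n.+1).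
Implicit Types (U V : {set {set 'I_n.+1}}).

Lemma mem_Aset U S L a :
  (a \in Aset U S L)
  = [&& a \in S, a \notin L & (a |: L \in U) (+) odd (card_gt L a)].
Proof.
rewrite !inE; case: (a \in L); case: (a \in S) => //=.
by case: (_ \in U); case: (odd _).
Qed.

(** Membership is monotone along the packet for both kinds of segment, so equal values at two places
    force the same value between them. *)
Lemma bruhat_triple k V M x y z :
  V \in bruhat n k -> #|M| = k.+2 ->
  x \in M -> y \in M -> z \in M -> (x < y < z)%N ->
  (M :\ x \in V) = (M :\ z \in V) -> (M :\ y \in V) = (M :\ x \in V).
Proof.
rewrite inE => /andP[_ /forall_inP VP] cM xM yM zM /andP[xy yz].
have xz := ltn_trans xy yz.
have: M \in ksubsets [set: 'I_n.+1] k.+2 by rewrite inE subsetT cM eqxx.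
move/VP/orP=> -[] /forall_inP seg.
  have sg u v : u \in M -> v \in M -> (u < v)%N ->
      (M :\ u \in V) ==> (M :\ v \in V).
    by move=> uM vM uv; move/forall_inP: (seg u uM) => /(_ v vM); rewrite uv.
  move: (sg x y xM yM xy) (sg y z yM zM yz).
  by case: (M :\ x \in V); case: (M :\ y \in V); case: (M :\ z \in V).
have sg u v : u \in M -> v \in M -> (u < v)%N ->
    (M :\ v \in V) ==> (M :\ u \in V).
  by move=> uM vM uv; move/forall_inP: (seg u uM) => /(_ v vM); rewrite uv.
move: (sg x y xM yM xy) (sg y z yM zM yz).
by case: (M :\ x \in V); case: (M :\ y \in V); case: (M :\ z \in V).
Qed.

Lemma card_gtD1r L l a : l \in L ->
  odd (card_gt L a) = (a < l)%N (+) odd (card_gt (L :\ l) a).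
Proof. by move=> lL; rewrite !card_gtE (big_setD1 l) //= oddD oddb. Qed.

(** In every case that remains, one of the two triple conditions has a true premise and a false
    conclusion. *)
Local Ltac cases_in V :=
  do 3! [case: (_ \in V)] => //= h1 h2;
  first [by have := h1 erefl | by have := h2 erefl].

Section Step.
Variables (k : nat) (V V' : {set {set 'I_n.+1}}) (L : {set 'I_n.+1}).
Hypotheses (bV : V \in bruhat n k) (bV' : V' \in bruhat n k).
Hypothesis (VV' : inv_set V V' = [set L]).

Lemma step_mem X : (X \in V') = (X \in V) (+) (X == L).
Proof.
move/setP/(_ X): VV'; rewrite !inE.
by case: (X \in V); case: (X \in V'); case: (X == L).
Qed.

Lemma step_card : #|L| = k.+1.
Proof.
have: L \in V :|: V'.
  by rewrite inE step_mem eqxx; case: (L \in V).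
move: bV bV'; rewrite !inE => /andP[/subsetP sV _] /andP[/subsetP sV' _].
by case/orP => [/sV|/sV']; rewrite inE => /andP[_ /eqP].
Qed.

(** The sets [V] and [V'] disagree only at [L], and [a |: L :\ l] is [L] only for [a = l], which is
    removed on both sides. *)
Lemma step_Aset l : l \in L ->
  Aset V' setT (L :\ l) :\ l = Aset V setT (L :\ l) :\ l.
Proof.
move=> lL; apply/setP => a; rewrite !(inE, mem_Aset) /=.
case: eqVneq => //= al; case: (boolP (a \in L)) => //= aL.
rewrite step_mem; suff /negPf -> : a |: L :\ l != L by rewrite addbF.
by apply: contraNneq aL => <-; rewrite setU11.
Qed.

(* With [M = L u {a}], the packet of [M] is cut into a beginning or ending
   segment both by [V] and by [V'], which differ only at [M \ a]. So membership
   in [V'] is constant on each side of [M \ a] in the packet and opposite on the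
   two sides; the parity of [card_gt (L :\ l) a] changes at the same place. *)
Lemma step_Aset_indep_lt l l' : l \in L -> l' \in L -> (l < l')%N ->
  Aset V' setT (L :\ l) :\ l = Aset V' setT (L :\ l') :\ l'.
Proof.
move=> lL lL' ll'; apply/setP => a; rewrite !(in_setD1, mem_Aset) !inE /=.
case: (boolP (a \in L)) => aL; first by case: (a == l); case: (a == l').
have al : a != l by apply: contraNneq aL => ->.
have al' : a != l' by apply: contraNneq aL => ->.
rewrite al al' /=.
have aD j : a != j -> a |: L :\ j = (a |: L) :\ j.
  by move=> aj; rewrite [RHS]setUD1r // inE eq_sym.
have M_L : (a |: L) :\ a = L by rewrite setU1K.
have cM : #|a |: L| = k.+2 by rewrite cardsU1 aL step_card.
have memV' j : j \in L -> (a |: L) :\ j \in V = ((a |: L) :\ j \in V').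
  move=> jL; rewrite step_mem; suff /negPf -> : (a |: L) :\ j != L.
    by rewrite addbF.
  by apply: contraTneq jL => <-; rewrite setD11.
have LV : (L \in V) = ~~ (L \in V').
  by rewrite step_mem eqxx addbT negbK.
have tV := bruhat_triple bV cM; have tV' := bruhat_triple bV' cM.
have lM : l \in a |: L by rewrite setU1r.
have lM' : l' \in a |: L by rewrite setU1r.
have aM : a \in a |: L by rewrite setU11.
have ltja j : j \in L -> (j <= a)%N -> (j < a)%N.
  move=> jL ja; rewrite ltn_neqAle ja andbT.
  by apply: contraNneq aL => /val_inj <-.
rewrite !aD //.
have -> : odd (card_gt (L :\ l) a) = (a < l)%N (+) odd (card_gt L a).
  by rewrite (card_gtD1r _ lL) addKb.
have -> : odd (card_gt (L :\ l') a) = (a < l')%N (+) odd (card_gt L a).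
  by rewrite (card_gtD1r _ lL') addKb.
rewrite !addbA; congr (_ (+) _).
(* With [M] as above, what is left is that [M \ l] and [M \ l'] have equal membership in [V'] unless
   [a] lies between [l] and [l'], when they differ. *)
case: (ltnP a l) => [a_l|/(ltja _ lL) la];
  last case: (ltnP a l') => [a_l'|/(ltja _ lL') la'].
- have ord : (a < l < l')%N by rewrite a_l.
  rewrite (ltn_trans a_l ll').
  move: (tV _ _ _ aM lM lM' ord) (tV' _ _ _ aM lM lM' ord).
  rewrite M_L !memV' // LV; cases_in V'.
- have ord : (l < a < l')%N by rewrite la.
  move: (tV _ _ _ lM aM lM' ord) (tV' _ _ _ lM aM lM' ord).
  rewrite M_L !memV' // LV; cases_in V'.
have ord : (l < l' < a)%N by rewrite ll'.
move: (tV _ _ _ lM lM' aM ord) (tV' _ _ _ lM lM' aM ord).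
rewrite M_L !memV' // LV; cases_in V'.
Qed.

Lemma initial_vertexE l : l \in L ->
  initial_vertex V' L = Aset V' setT (L :\ l) :\ l.
Proof.
move=> lL; rewrite /initial_vertex; case: pickP => [j jL|/(_ l)]; last first.
  by rewrite /= lL.
have [jl|lj|/val_inj -> //] := ltngtP j l; first exact: step_Aset_indep_lt.
by rewrite (step_Aset_indep_lt lL jL).
Qed.

(** The vertex can be computed from the very [l] that has to be excluded. *)
Lemma disjoint_initial_vertex : [disjoint L & initial_vertex V' L].
Proof.
rewrite disjoint_subset; apply/subsetP => l lL.
by rewrite !inE (initial_vertexE lL) setD11.
Qed.

End Step.
End Bruhat.

(** * Faces restricted to a simplex *)

Section Faces.
Variable n : nat.
Implicit Types (X S L A : {set 'I_n.+1}) (v l a : 'I_n.+1).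
Implicit Types (U V : {set {set 'I_n.+1}}).

(** The value of [coprod_face L A] at [S], extended to [S = set0] so that [linext_basis] applies. *)
Definition face_term L A S : chains2 n :=
  if L \subset S then coprod_term S L (A :&: S) (~: (L :|: A) :&: S) else 0.

Definition gen_term V S L : chains2 n :=
  coprod_term S L (Aset V S L) (Bset V S L).

Lemma setD1_notin X v : v \notin X -> X :\ v = X.
Proof. by move=> vX; apply/setDidPl; rewrite disjoint_sym disjoints1. Qed.

Lemma face_term_D1 L A S v : L \subset S -> v \notin L ->
  face_term L A (S :\ v)
  = coprod_term (S :\ v) L ((A :&: S) :\ v) ((~: (L :|: A) :&: S) :\ v).
Proof.
by move=> LS vL; rewrite /face_term subsetD1 LS vL !setIDA.
Qed.

Lemma face_partition L A S : [disjoint L & A] -> L \subset S ->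
  [/\ [disjoint L & A :&: S], [disjoint L & ~: (L :|: A) :&: S],
      [disjoint A :&: S & ~: (L :|: A) :&: S]
    & S = L :|: A :&: S :|: ~: (L :|: A) :&: S].
Proof.
move=> dLA /subsetP LS; rewrite -!setI_eq0; split;
  (apply/setP || apply/eqP/setP) => v; rewrite !inE.
- by case: (boolP (v \in L)) => //= vL; rewrite (disjointFr dLA).
- by case: (v \in L).
- by case: (v \in A); rewrite ?orbT ?andbF.
by move: (LS v); case: (v \in L) => [->|]; case: (v \in A); case: (v \in S).
Qed.

(** Removing a vertex of [L] leaves a simplex that does not contain [L], where the face coproduct
    vanishes. Only vertices of [A] and [B] contribute. *)
Lemma coprod_face_bdry L A S : [disjoint L & A] -> (0 < #|L|)%N ->
  coprod_face L A (bdry_basis S)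
  = if L \subset S then
      \sum_(a in A :&: S)
         coprod_term (S :\ a) L ((A :&: S) :\ a) (~: (L :|: A) :&: S)
           *~ (-1) ^+ card_lt S a
      + \sum_(b in ~: (L :|: A) :&: S)
         coprod_term (S :\ b) L (A :&: S) ((~: (L :|: A) :&: S) :\ b)
           *~ (-1) ^+ card_lt S b
    else 0.
Proof.
move=> dLA L0; have F0 : face_term L A set0 = 0.
  by rewrite /face_term subset0 -cards_eq0 eqn0Ngt L0.
have -> : coprod_face L A (bdry_basis S)
    = \sum_(v in S) face_term L A (S :\ v) *~ (-1) ^+ card_lt S v.
  rewrite bdry_basisE /coprod_face linext_sum; apply: eq_bigr => v _.
  by rewrite linextMz (linext_basis _ F0).
case: ifPn => [LS|LS]; last first.
  apply: big1 => v _; rewrite /face_term subsetD1 (negPf LS) /=.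
  exact: mul0rz.
have [d1 d2 d3 SE] := face_partition dLA LS.
have -> (F : 'I_n.+1 -> chains2 n) : \sum_(v in S) F v
    = \sum_(v in L) F v + \sum_(v in A :&: S) F v
      + \sum_(v in ~: (L :|: A) :&: S) F v.
  by rewrite -!sum_disjointU // -?SE // -setI_eq0 setIUl setU_eq0 !setI_eq0 d2.
rewrite big1 ?add0r => [|l lL].
  congr (_ + _); apply: eq_bigr => v vX.
    have vL : v \notin L by rewrite (disjointFl d1).
    have vB : v \notin ~: (L :|: A) :&: S by rewrite (disjointFr d3).
    by rewrite (face_term_D1 A LS vL) (setD1_notin vB).
  have vL : v \notin L by rewrite (disjointFl d2).
  have vA : v \notin A :&: S by rewrite (disjointFl d3).
  by rewrite (face_term_D1 A LS vL) (setD1_notin vA).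
by rewrite /face_term subsetD1 lL andbF; exact: mul0rz.
Qed.

Lemma bdry2_face_term L A S : [disjoint L & A] -> (0 < #|L|)%N ->
  bdry2 (face_term L A S)
  = (if L \subset S then
       \sum_(l in L)
         (coprod_term S (L :\ l) (A :&: S) (l |: ~: (L :|: A) :&: S)
          - coprod_term S (L :\ l) (l |: A :&: S) (~: (L :|: A) :&: S))
            *~ (-1) ^+ card_gt L l
     else 0)
    + coprod_face L A (bdry_basis S) *~ (-1) ^+ #|L|.-1.
Proof.
move=> dLA L0; rewrite coprod_face_bdry // /face_term.
case: ifP => [LS|_]; last first.
  by rewrite mul0rz addr0 /bdry2 /linext big1 // => p _; rewrite ffunE.
have [d1 d2 d3 SE] := face_partition dLA LS.
exact: bdry2_coprod_term.
Qed.

(** Away from [l], the set [Aset V S (L :\ l)] is [A :&: S]. The place of [l] itself is decided by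
    the membership of [L] in [V] and a parity, which selects one of two opposite facets of the
    face. *)
Lemma gen_termE V S L l A : l \in L -> L \subset S ->
  Aset V setT (L :\ l) :\ l = A ->
  gen_term V S (L :\ l)
  = if (L \in V) (+) odd (card_gt L l)
    then coprod_term S (L :\ l) (l |: A :&: S) (~: (L :|: A) :&: S)
    else coprod_term S (L :\ l) (A :&: S) (l |: ~: (L :|: A) :&: S).
Proof.
move=> lL LS AE; set c := _ (+) _.
have lS : l \in S by apply: (subsetP LS).
have lA : l \in Aset V S (L :\ l) = c.
  by rewrite mem_Aset lS setD11 setD1K // card_gtD1.
have aA a : a != l -> a \in Aset V S (L :\ l) = (a \in A :&: S).
  move=> al; rewrite -AE in_setI mem_Aset !in_setD1 mem_Aset !in_setD1 in_setT.
  by rewrite al andbC.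
have aL a : a \in A -> a \notin L.
  by rewrite -AE in_setD1 mem_Aset in_setD1 => /andP[-> /and3P[]].
have A_l : l \notin A by rewrite -AE setD11.
rewrite /gen_term /Bset.
have -> : Aset V S (L :\ l) = if c then l |: A :&: S else A :&: S.
  apply/setP => a; have [->|al] := eqVneq a l.
    by rewrite lA; case: (c); rewrite !inE ?eqxx // (negPf A_l).
  by rewrite aA //; case: (c); rewrite !inE ?(negPf al).
case: (c); congr coprod_term; apply/setP => a; rewrite !inE.
  case: eqVneq => [->|al] /=; first by rewrite lL.
  by move/subsetP/(_ a): LS; case: (a \in L); case: (a \in A); case: (a \in S).
case: eqVneq => [->|al] /=; first by rewrite lS (negPf A_l).
by move/subsetP/(_ a): LS; case: (a \in L); case: (a \in A); case: (a \in S).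
Qed.

(** * Facet terms across one step *)

Section Step.
Variables (k : nat) (V V' : {set {set 'I_n.+1}}) (L : {set 'I_n.+1}).
Hypotheses (bV : V \in bruhat n k) (bV' : V' \in bruhat n k).
Hypothesis (VV' : inv_set V V' = [set L]).
Let A := initial_vertex V' L.

Lemma gen_term_step S L' :
  (forall a, a \in S -> a \notin L' -> a |: L' != L) ->
  gen_term V S L' = gen_term V' S L'.
Proof.
move=> neL; rewrite /gen_term /Bset.
suff -> : Aset V S L' = Aset V' S L' by [].
apply/setP => a; rewrite !mem_Aset (step_mem VV').
case: (boolP (a \in S)) => //= aS; case: (boolP (a \in L')) => //= aL'.
by rewrite (negPf (neL a aS aL')) addbF.
Qed.

(** A term changes only if one more vertex of [S] completes [L'] to [L], that is, if [L'] is some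
    [L :\ l] and [L] is contained in [S]. *)
Lemma gen_term_step_sum S :
  \sum_(L' in ksubsets S k) (gen_term V S L' - gen_term V' S L')
  = if L \subset S then
      \sum_(l in L) (gen_term V S (L :\ l) - gen_term V' S (L :\ l))
    else 0.
Proof.
have cL := step_card bV bV' VV'.
case: ifPn => LS; last first.
  apply: big1 => L'; rewrite inE => /andP[L'S _].
  rewrite gen_term_step ?subrr // => a aS _.
  by apply: contraNneq LS => <-; rewrite subUset sub1set aS.
have inj : {in L &, injective (fun l => L :\ l)}.
  move=> l j lL jL /setP/(_ l); rewrite !inE eqxx lL andbT /=.
  by case: eqVneq.
rewrite (big_setID [set L :\ l | l in L]) /= [X in _ + X]big1 => [|L'];
  last first.
  rewrite !inE => /andP[L'L _]; rewrite gen_term_step ?subrr // => a _ aL'.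
  apply: contraNneq L'L => aL'E; apply/imsetP.
  exists a; first by rewrite -aL'E setU11.
  by rewrite -aL'E setU1K.
rewrite addr0.
rewrite -(big_imset (fun L' => gen_term V S L' - gen_term V' S L') inj) /=.
apply: eq_bigl => L'; rewrite inE andb_idl // => /imsetP[l lL ->].
have := cL; rewrite inE (subset_trans (subD1set _ _) LS) (cardsD1 l L) lL add1n.
by case=> ->; rewrite eqxx.
Qed.

(** Exactly one of [V], [V'] contains [L], so they select opposite facets for every [l]; by
    [sub_toggle] one common sign governs their order. *)
Lemma bdry2_step S :
  bdry2 (face_term L A S)
  = (\sum_(L' in ksubsets S k) (gen_term V S L' - gen_term V' S L'))
      *~ (-1) ^+ (L \notin V')
    + coprod_face L A (bdry_basis S) *~ (-1) ^+ k.
Proof.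
have cL := step_card bV bV' VV'.
have dLA := disjoint_initial_vertex bV bV' VV'.
rewrite bdry2_face_term ?cL //; congr (_ + _).
rewrite gen_term_step_sum; case: ifPn => LS; last exact: esym (mul0rz _ _).
rewrite mulrz_suml; apply: eq_bigr => l lL.
have AE := esym (initial_vertexE bV bV' VV' lL).
have AE' : Aset V setT (L :\ l) :\ l = A by rewrite -(step_Aset VV').
rewrite (gen_termE lL LS AE) (gen_termE lL LS AE') (step_mem VV' L) eqxx addbT.
by rewrite negbK -[(-1) ^+ card_gt L l]signr_odd (sub_toggle _ _ (L \in V)).
Qed.
End Step.

(** For [a] outside [L] the set [a |: L] has [#|L|.+1] elements, so complementing [U] flips its
    membership and exchanges [A] and [B], as the twist does with the factors. The signs are compared
    through [cross_sym]. *)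
Lemma twist_gen_term U S L : L \subset S -> (0 < #|L|)%N ->
  twist (gen_term U S L) *~ (-1) ^+ #|L|
  = - gen_term (ksubsets [set: 'I_n.+1] #|L|.+1 :\: U) S L.
Proof.
move=> LS L0; set A := Aset U S L; set B := Bset U S L.
have dLA : [disjoint L & A].
  rewrite -setI_eq0; apply/eqP/setP => v; rewrite in_setI mem_Aset inE.
  by case: (v \in L); rewrite ?andbF.
have dLAB : [disjoint L :|: A & B].
  rewrite -setI_eq0; apply/eqP/setP => v; rewrite in_setI in_setD in_set0.
  by case: (v \in L :|: A).
have dAB : [disjoint A & B] := disjointWl (subsetUr _ _) dLAB.
have LAS : L :|: A \subset S.
  by rewrite subUset LS; apply/subsetP => v; rewrite mem_Aset => /andP[].
have SE : #|S| = (#|L| + #|A| + #|B|)%N.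
  by rewrite -(card_disjointU dLA) -(cardsID (L :|: A) S) (setIidPr LAS).
have -> : gen_term (ksubsets [set: 'I_n.+1] #|L|.+1 :\: U) S L
  = coprod_term S L B A.
  rewrite /gen_term /Bset.
  have -> : Aset (ksubsets [set: 'I_n.+1] #|L|.+1 :\: U) S L = B.
    apply/setP => a; rewrite mem_Aset !in_setD in_setU mem_Aset inE.
    case: (boolP (a \in S)) => //= aS; last by rewrite andbF.
    case: (boolP (a \in L)) => //= aL; rewrite subsetT cardsU1 aL add1n eqxx.
    by rewrite !andbT addNb.
  congr coprod_term; apply/setP => a; rewrite !(in_setD, in_setU).
  have := subsetP LAS a; rewrite in_setU.
  case: (boolP (a \in L)) => [aL _|_] /=; first by rewrite (disjointFr dLA).
  by case: (a \in A); case: (a \in S) => // /(_ isT).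
rewrite /gen_term /coprod_term /twist linextMz -/A -/B.
have U0 X : L :|: X != set0 by rewrite setU_eq0 -cards_eq0 eqn0Ngt L0.
rewrite (linext_tens_basis (fun X Y => tens (basis Y) (basis X)
  *~ (-1) ^+ (deg X * deg Y)%N)) // !signz_add.
rewrite -[RHS]mulrNz -(mulN1r (_ ^+ eps _ _ _ _)) -exprS.
apply: signz_eq; rewrite !epsE SE /deg !card_disjointU //; last first.
  exact: disjointWl (subsetUl _ _) dLAB.
have := cross_sym dAB; rewrite -(prednK L0) !addSn /= => /(congr1 odd).
parity.
Qed.

End Faces.

(** * Summation along the chain *)

Section Main.
Variable n : nat.
Implicit Types (L : {set 'I_n.+1}).
Implicit Types (U V : {set {set 'I_n.+1}}) (W : seq {set {set 'I_n.+1}}).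

Lemma bdry2_coprod_face i V V' L c :
  V \in bruhat n i.+1 -> V' \in bruhat n i.+1 -> inv_set V V' = [set L] ->
  let D := coprod_face L (initial_vertex V' L) in
  bdry2 (D c) - D (bdry c) *~ (-1) ^+ i.+1
  = (coprod i V c - coprod i V' c) *~ (-1) ^+ (L \notin V').
Proof.
move=> bV bV' VV' D; rewrite /D /coprod_face /bdry2 /bdry /coprod.
rewrite !linext_linext !linext_mulzf !linext_oppf !linext_addf linext_mulzf.
apply: eq_linext => X; apply: (canLR (addrK _)); rewrite -sumrB.
exact: bdry2_step bV bV' VV' (val X).
Qed.

Lemma twist_coprod i U c :
  twist (coprod i U c) *~ (-1) ^+ i.+1
  = - coprod i (ksubsets [set: 'I_n.+1] i.+2 :\: U) c.
Proof.
rewrite /twist /coprod linext_linext linext_mulzf linext_oppf.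
apply: eq_linext => X; rewrite linext_sum mulrz_suml -sumrN.
apply: eq_bigr => L; rewrite inE => /andP[LX /eqP cL].
rewrite -/(gen_term _ _ _) -/(gen_term _ _ _) -cL.
by apply: twist_gen_term; rewrite ?cL.
Qed.

(** The symmetric differences with [U] cancel and leave [L]. As [L] is in [inv_set U V'], it lies in
    exactly one of [U] and [V']; this links the sign of [bdry2_coprod_face] to the one in
    [coprod_chain]. *)
Lemma covers_step U V V' : covers U V V' ->
  exists2 L, inv_set V V' = [set L] & (L \notin V') = (L \in U).
Proof.
case/existsP=> L /andP[LV /eqP VV']; exists L; last first.
  have := setU11 L (inv_set U V); rewrite -VV' !inE.
  by case: (L \in U); case: (L \in V').
apply/setP => X; move/setP/(_ X): VV'; rewrite !inE.
have [->|_] := eqVneq X L.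
  by move: LV; rewrite !inE; do 3?case: (L \in _).
by case: (X \in U); case: (X \in V); case: (X \in V').
Qed.

Lemma step_setE W q L :
  inv_set (nth set0 W q.-1) (nth set0 W q) = [set L] -> step_set W q = L.
Proof.
rewrite /step_set => ->; case: pickP => [X /set1P //|/(_ L)].
by rewrite set11.
Qed.

Lemma coprod_chainE U W c :
  coprod_chain U W c
  = \sum_(1 <= q < size W) coprod_step W q c *~ (-1) ^+ (step_set W q \in U).
Proof.
rewrite /coprod_chain [X in X - _]big_mkcond [X in _ - X]big_mkcond -sumrB.
apply: eq_bigr => q _; case: (_ \in U); first by rewrite sub0r mulrN1z.
by rewrite subr0 mulr1z.
Qed.
End Main.

Theorem theorem4p9 (n i : nat) (U : {set {set 'I_n.+1}})
    (W : seq {set {set 'I_n.+1}}) :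
  U \in bruhat n i.+1 -> maximal_chain i.+1 U W ->
  forall c : chains n,
    bdry2 (coprod_chain U W c) - coprod_chain U W (bdry c) *~ (-1) ^+ i.+1
    = coprod i U c + twist (coprod i U c) *~ (-1) ^+ i.+1.
Proof.
move=> bU; case: W => [|V0 W] /and4P[] // /andP[_ /allP bW] /eqP[->].
move=> /(pathP set0) covW /eqP lastW c.
have bq q : (q <= size W)%N -> nth set0 (U :: W) q \in bruhat n i.+1.
  by case: q => //= q qW; apply/bW/mem_nth.
(* The twisted term becomes minus the coproduct of the endpoint of the chain. *)
rewrite twist_coprod -lastW !coprod_chainE mulrz_suml.
rewrite [bdry2 _]linext_sum -sumrB.
(* The sign of a step in the chain equals the sign of its boundary formula, so their product is 1
   and each step contributes a plain difference. *)
rewrite (eq_big_nat _ _ (F2 := fun q => coprod i (nth set0 (U :: W) q.-1) c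
    - coprod i (nth set0 (U :: W) q) c)) => [|q /andP[q0 qW]]; last first.
  have /covers_step[L VV' LU] :
      covers U (nth set0 (U :: W) q.-1) (nth set0 (U :: W) q).
    by case: q q0 qW => // q _ qW; apply: covW.
  rewrite /coprod_step (step_setE VV') linextMz -mulrzA [_ * (-1) ^+ i.+1]mulrC.
  have bp := bq _ (leq_trans (leq_pred q) qW).
  rewrite mulrzA -mulrzBl (bdry2_coprod_face _ bp (bq q qW) VV').
  by rewrite LU -mulrzA -expr2 sqrr_sign mulr1z.
(* The index is shifted to start at 0, and [telescope_sumr] expects the later term first, hence the
   negation. *)
rewrite big_add1 /= (eq_bigr (fun q => - (coprod i (nth set0 (U :: W) q.+1) c
    - coprod i (nth set0 (U :: W) q) c))) => [|q _]; last by rewrite opprB.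
rewrite sumrN (telescope_sumr (fun q => coprod i (nth set0 (U :: W) q) c)) //.
by rewrite opprB (nth_last set0 (U :: W)).
Qed.
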